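(* Let $(d_i)_{i \ge 0}$ be a sequence of nonnegative integers such that $d_0=1$ and $d_{i+1} \le d_i^{\langle i \rangle}$ for all $i \ge 1$. Then there exist an abelian semigroup $G$ and a subset $A \subseteq G$ such that $d_h \le |hA| \le d_h+1$ for all $h \ge 0$.
   Context: Binomial representation: let $h \ge 1$ be an integer. For every integer $a \ge 1$ there are unique integers $a_h > a_{h-1} > \cdots > a_1 \ge 0$ such that $a = \sum_{j=1}^h \binom{a_j}{j}$ (the $h$-binomial representation of $a$), where $\binom{m}{j}=0$ for integers $0 \le m < j$. With this representation one sets $a^{\langle h \rangle} = \sum_{j=1}^h \binom{a_j+1}{j+1}$. One also sets $0^{\langle h \rangle}=0$. Iterated sumsets: for a subset $A$ of an abelian semigroup $(G,+)$ and an integer $h \ge 1$, $hA = A + \cdots + A$ ($h$ summands) is the set of all sums $a_1+\cdots+a_h$ with $a_1,\dots,a_h \in A$ (repetitions allowed). For $h=0$, $0A$ is by convention the one-element set $\{0\}$, so $|0A|=1$. *)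

(* Defs.v *)
From mathcomp Require Import all_boot all_algebra.
From mathcomp Require Import boolp classical_sets functions cardinality.

Set Implicit Arguments.
Unset Strict Implicit.
Unset Printing Implicit Defensive.

Local Open Scope classical_set_scope.

(* a = sum_{1 <= j <= h} C(a_j, j), where [r i] stands for a_{i+1}. *)
Definition is_binomial_rep (h a : nat) (r : {ffun 'I_h -> nat}) : Prop :=
  (forall i j : 'I_h, i < j -> r i < r j)%N /\
  a = (\sum_(j < h) 'C(r j, j.+1))%N.

Definition incr_below (h : nat) (r : nat -> nat) : Prop :=
  forall i j, (i < j < h)%N -> (r i < r j)%N.

Lemma incr_belowS h r : incr_below h.+1 r -> incr_below h r.
Proof.
by move=> H i j /andP[ij jh]; apply: H; rewrite ij (ltn_trans jh).
Qed.

Lemma sum_bin_lt r h m : incr_below h r -> (forall j, j < h -> r j < m)%N ->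
  (\sum_(j < h) 'C(r j, j.+1) < 'C(m, h))%N.
Proof.
elim: h m => [|h IH] m Hr Hm; first by rewrite big_ord0 bin0.
rewrite big_ord_recr /=.
have lt1 : (\sum_(j < h) 'C(r j, j.+1) < 'C(r h, h))%N.
  by apply: IH (incr_belowS Hr) _ => j jh; apply: Hr; rewrite jh /=.
have : ('C((r h).+1, h.+1) <= 'C(m, h.+1))%N by apply: leq_bin2l; apply: Hm.
by rewrite binS; apply: leq_trans; rewrite addnC ltn_add2l.
Qed.

Lemma sum_bin_inj r s h : incr_below h r -> incr_below h s ->
  (\sum_(j < h) 'C(r j, j.+1) = \sum_(j < h) 'C(s j, j.+1))%N ->
  forall j, (j < h)%N -> r j = s j.
Proof.
have aux r1 r2 k : incr_below k.+1 r1 -> incr_below k.+1 r2 -> (r1 k < r2 k)%N ->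
    (\sum_(j < k.+1) 'C(r1 j, j.+1) < \sum_(j < k.+1) 'C(r2 j, j.+1))%N.
  move=> H1 H2 lt12; rewrite [X in (_ < X)%N]big_ord_recr /=.
  apply: leq_trans (leq_addl _ _); apply: sum_bin_lt => // j.
  rewrite ltnS leq_eqVlt => /orP[/eqP-> //|jk].
  by apply: ltn_trans lt12; apply: H1; rewrite jk /=.
elim: h => // h IH Hr Hs E.
have Eh : r h = s h.
  case: (ltngtP (r h) (s h)) => // lt12.
    by have := aux _ _ _ Hr Hs lt12; rewrite E ltnn.
  by have := aux _ _ _ Hs Hr lt12; rewrite E ltnn.
move=> j; rewrite ltnS leq_eqVlt => /orP[/eqP-> //|].
apply: IH (incr_belowS Hr) (incr_belowS Hs) _ _; move: E.
by rewrite !big_ord_recr /= Eh => /addIn.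
Qed.

Lemma sum_bin_exists h m a : (a < 'C(m, h))%N -> exists r,
  [/\ incr_below h r, (forall j, j < h -> r j < m)%N &
      a = (\sum_(j < h) 'C(r j, j.+1))%N].
Proof.
elim: h m a => [|h IH] m a am.
  exists id; split=> // [i j /andP[]//|].
  by rewrite big_ord0; move: am; rewrite bin0; case: a.
have P0 : exists n, ('C(n, h.+1) <= a)%N by exists 0%N; rewrite bin0n.
have Pm n : ('C(n, h.+1) <= a)%N -> (n <= m)%N.
  move=> na; rewrite leqNgt; apply/negP => mn.
  have := leq_trans (leq_bin2l h.+1 (ltnW mn)) na.
  by rewrite leqNgt am.
case: (ex_maxnP P0 Pm) => n na nmax.
have nm : (n < m)%N.
  rewrite ltn_neqAle Pm // andbT; apply/eqP => nm.
  by move: na; rewrite nm leqNgt am.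
have : (a - 'C(n, h.+1) < 'C(n, h))%N.
  rewrite -(ltn_add2l 'C(n, h.+1)) subnKC // -binS ltnNge.
  by apply/negP => /nmax; rewrite ltnn.
case/IH => r [Hr rn ra].
exists (fun j => if (j < h)%N then r j else n); split.
- move=> i j /andP[ij]; rewrite ltnS leq_eqVlt => /orP[/eqP jh|jh].
    by rewrite jh ltnn -jh ij rn // -jh.
  by rewrite (ltn_trans ij jh) jh; apply: Hr; rewrite ij.
- by move=> j _; case: ifP => // jh; apply: ltn_trans (rn _ jh) nm.
rewrite big_ord_recr /= ltnn; under eq_bigr => j _ do rewrite ltn_ord.
by rewrite -ra subnK.
Qed.

Lemma binomial_rep_exists (h a : nat) :
  (0 < h)%N -> exists r, @is_binomial_rep h a r.
Proof.
case: h => // h _.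
have : (a < 'C(a + h.+1, h.+1))%N.
  elim: a => [|a IH]; first by rewrite binn.
  by rewrite addSn binS -addn1 leq_add // bin_gt0 addnS ltnW // ltnS leq_addl.
case/sum_bin_exists => r [Hr _ ->].
exists [ffun j : 'I_h.+1 => r j]; split=> [i j ij|].
  by rewrite !ffunE; apply: Hr; rewrite ij ltn_ord.
by apply: eq_bigr => j _; rewrite ffunE.
Qed.

Lemma binomial_rep_unique (h a : nat) (r s : {ffun 'I_h -> nat}) :
  is_binomial_rep a r -> is_binomial_rep a s -> r = s.
Proof.
case: h r s => [|h] r s; first by move=> _ _; apply/ffunP => -[].
pose f (t : {ffun 'I_h.+1 -> nat}) j := t (inord j).
have incr_f t : is_binomial_rep a t -> incr_below h.+1 (f t).
  case=> Ht _ i j /andP[ij jh]; apply: Ht.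
  by rewrite !inordK // (ltn_trans ij).
have sum_f t : is_binomial_rep a t ->
    (\sum_(j < h.+1) 'C(f t j, j.+1))%N = a.
  by case=> _ ->; apply: eq_bigr => j _; rewrite /f inord_val.
move=> Hr Hs; apply/ffunP => j.
have := sum_bin_inj (incr_f _ Hr) (incr_f _ Hs).
rewrite !sum_f // => /(_ erefl j (ltn_ord j)).
by rewrite /f inord_val.
Qed.

Definition binomial_rep (h a : nat) : {ffun 'I_h -> nat} :=
  xget [ffun=> 0%N] [set r | is_binomial_rep a r].

Lemma binomial_repP (h a : nat) :
  (0 < h)%N -> is_binomial_rep a (binomial_rep h a).
Proof. by move=> /(binomial_rep_exists a); apply: xgetPex. Qed.

(* The operation a^<h>; only meaningful for h >= 1. *)
Definition macaulay (h a : nat) : nat :=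
  if a == 0%N then 0%N
  else (\sum_(j < h) 'C((binomial_rep h a j).+1, j.+2))%N.

(* MathComp's [addSemigroupType] is commutative by definition. *)
Fixpoint sumsetS (G : addSemigroupType) (A : set G) (k : nat) : set G :=
  if k is k'.+1 then [set (a + b)%R | a in A & b in sumsetS A k'] else A.

(* [sumsetS A k] is (k+1)A.  A semigroup need not have a zero, so hA is viewed *)
(* in [option G], where [None] is the element 0 of 0A = {0}.                   *)
Definition sumset (G : addSemigroupType) (A : set G) (h : nat) :
    set (option G) :=
  if h is k.+1 then Some @` sumsetS A k else [set None].

(* Main.v *)
(* Weakly increasing sequences x_1 <= ... <= x_h stand for the monomials of
   degree h in variables indexed by nat; put a_j = x_j + j - 1.  Then
   x |-> sum_j C(a_j, j) numbers the monomials of degree h by the natural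
   numbers.  Keep the monomials of degree h whose number is < d_h.  Among the
   divisors obtained by removing one variable, the one removing x_1 has the
   largest number, namely P = sum_j C(a_{j+1} - 1, j), and P^<h> <= N where N
   is the number of x in degree h+1.  By monotonicity of a |-> a^<h>, if
   N < d_{h+1} <= d_h^<h> then P < d_h.  So the kept monomials are closed under
   divisors; adjoining an absorbing element that receives all discarded
   products gives a semigroup, and A is the set of kept variables. *)
From HB Require Import structures.
Require Import Defs.
From mathcomp Require Import all_boot all_algebra.
From mathcomp Require Import boolp classical_sets functions cardinality.

Set Implicit Arguments.
Unset Strict Implicit.
Unset Printing Implicit Defensive.

Local Open Scope classical_set_scope.

(** * Monotonicity of the operation a^<h> *)

Lemma incr_below_lt h r m : incr_below h.+1 r -> r h < m ->
  forall j, j < h.+1 -> r j < m.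
Proof.
move=> Hr rm j; rewrite ltnS leq_eqVlt => /orP[/eqP -> //|jh].
by apply: ltn_trans rm; apply: Hr; rewrite jh /=.
Qed.

(** This is [sum_bin_lt] for the sequence 0, r_0 + 1, ..., r_{h-1} + 1 of length h + 1, whose first
    term contributes 'C(0, 1) = 0. *)
Lemma sum_bin_succ_lt r h m : incr_below h r -> (forall j, j < h -> r j < m) ->
  \sum_(j < h) 'C((r j).+1, j.+2) < 'C(m.+1, h.+1).
Proof.
move=> Hr Hm.
have := @sum_bin_lt (fun j => if j is i.+1 then (r i).+1 else 0) h.+1 m.+1.
rewrite big_ord_recl /= bin0n add0n; apply.
- by case=> [|i] [|j] //= /andP[ij jh]; rewrite ltnS; apply: Hr; apply/andP.
- by case=> // j jh; apply: Hm.
Qed.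

(** The top entries decide: a larger one outweighs all terms of the other sum, before and after the
    shift, and equal ones cancel. *)
Lemma sum_bin_succ_le r s h : incr_below h r -> incr_below h s ->
  \sum_(j < h) 'C(r j, j.+1) <= \sum_(j < h) 'C(s j, j.+1) ->
  \sum_(j < h) 'C((r j).+1, j.+2) <= \sum_(j < h) 'C((s j).+1, j.+2).
Proof.
elim: h => [|h IH] Hr Hs; first by rewrite !big_ord0.
case: (ltngtP (r h) (s h)) => [rs|sr|E] le_rs.
- rewrite [X in _ <= X]big_ord_recr /=; apply: leq_trans (leq_addl _ _).
  exact/ltnW/sum_bin_succ_lt/incr_below_lt.
- have lt_s := sum_bin_lt Hs (incr_below_lt Hs sr).
  move: le_rs; rewrite [X in X <= _]big_ord_recr /= leqNgt.
  by rewrite (leq_trans lt_s (leq_addl _ _)).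
- move: le_rs; rewrite !big_ord_recr /= E !leq_add2r.
  exact: IH (incr_belowS Hr) (incr_belowS Hs).
Qed.

Lemma macaulay_le h a s : 0 < h -> incr_below h s ->
  a <= \sum_(j < h) 'C(s j, j.+1) ->
  macaulay h a <= \sum_(j < h) 'C((s j).+1, j.+2).
Proof.
case: h => // h _ Hs; rewrite /macaulay; case: eqP => // _.
have [Hr {1}->] := binomial_repP a (ltn0Sn h).
move: (binomial_rep _ _) Hr => r Hr.
have sumE F : \sum_(j < h.+1) F (r j) (nat_of_ord j)
            = \sum_(j < h.+1) F (r (inord j)) (nat_of_ord j).
  by apply: eq_bigr => j _; rewrite inord_val.
rewrite (sumE (fun x j => 'C(x, j.+1))) (sumE (fun x j => 'C(x.+1, j.+2))).
apply: (@sum_bin_succ_le (fun j => r (inord j))) => // i j /andP[ij jh].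
by apply: Hr; rewrite !inordK // (ltn_trans ij).
Qed.

(** * Numbering of the monomials of a given degree *)

Definition rank (s : seq nat) : nat :=
  \sum_(j < size s) 'C(nth 0 s j + j, j.+1).

Lemma sorted_incr_below s : sorted leq s ->
  incr_below (size s) (fun j => nth 0 s j + j).
Proof.
move=> Hs i j /andP[ij js]; rewrite -addnS leq_add //.
apply: (sorted_leq_nth leq_trans leqnn 0 Hs) (ltnW ij); rewrite inE //.
exact: ltn_trans js.
Qed.

Lemma rank_inj s t : sorted leq s -> sorted leq t -> size s = size t ->
  rank s = rank t -> s = t.
Proof.
move=> Hs Ht E; rewrite /rank -E => Er; apply: (eq_from_nth E) => j js.
have Ht' := sorted_incr_below Ht; rewrite -E in Ht'.
have /(_ j js)/addIn := sum_bin_inj (sorted_incr_below Hs) Ht' Er.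
exact.
Qed.

Lemma rank_surj h a : 0 < h ->
  exists s, [/\ sorted leq s, size s = h & rank s = a].
Proof.
case: h => // h _.
have [r [Hr ra]] := binomial_rep_exists a (ltn0Sn h).
pose f j := r (inord j).
have fS j : j < h -> f j < f j.+1.
  by move=> jh; apply: Hr; rewrite !inordK // ltnS // ltnW.
(* Needed for the truncated subtraction [f j - j] below to be exact. *)
have fge j : j <= h -> j <= f j.
  elim: j => // j IH jh; exact: leq_ltn_trans (IH (ltnW jh)) (fS _ jh).
exists (mkseq (fun j => f j - j) h.+1); split; last 2 first.
- by rewrite size_mkseq.
- rewrite /rank size_mkseq ra; apply: eq_bigr => j _.
  by rewrite nth_mkseq // subnK ?fge -1?ltnS // /f inord_val.
apply/(sortedP 0) => j; rewrite size_mkseq => jh.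
rewrite !nth_mkseq // ?(ltnW jh) //.
by rewrite -subSS leq_sub2r // fS.
Qed.

(** By contraposition: if [d <= rank s], monotonicity bounds [macaulay (size s) d] by the part of
    [rank (x :: s)] that remains without the term of [x]. *)
Lemma rank_behead d x s : 0 < size s -> sorted leq s ->
  rank (x :: s) < macaulay (size s) d -> rank s < d.
Proof.
move=> s0 Hs; rewrite !ltnNge; apply: contra => ds.
apply: leq_trans (macaulay_le s0 (sorted_incr_below Hs) ds) _.
rewrite /rank /= big_ord_recl /=; apply: leq_trans (leq_addl _ _).
by apply: leq_sum => j _; rewrite /= addnS.
Qed.

(** Removing the smallest variable is thus the worst case for the rank. *)
Lemma nth_rem_sorted x a s j : sorted leq (a :: s) -> x \in a :: s ->
  nth 0 (rem x (a :: s)) j <= nth 0 s j.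
Proof.
elim: s a j => [|b s IH] a j; first by rewrite inE /= eq_sym => _ ->.
rewrite inE [rem _ _]/=; case: eqVneq => //= _ /andP[ab bs] xs.
by case: j => //= j; apply: IH.
Qed.

(** * Kept monomials and their closure under divisors *)

Definition kept (d : nat -> nat) (s : seq nat) : bool :=
  rank (sort leq s) < d (size s).

Lemma perm_sort_leq s t : perm_eq s t -> sort leq s = sort leq t.
Proof. by move=> /(perm_sortP leq_total leq_trans anti_leq). Qed.

Lemma perm_kept d s t : perm_eq s t -> kept d s = kept d t.
Proof. by move=> st; rewrite /kept (perm_sort_leq st) (perm_size st). Qed.

Section Macaulay_semigroup.

Context (d : nat -> nat) (d0 : d 0 = 1).
Context (dS : forall i, 1 <= i -> d i.+1 <= macaulay i (d i)).

Lemma kept_behead x s : kept d (x :: s) -> kept d s.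
Proof.
(* The growth condition starts at degree 1; in degree 0 the empty monomial has rank 0 < d 0 = 1. *)
case: s => [|y s]; first by rewrite /kept /rank big_ord0 d0.
move: (y :: s) (ltn0Sn (size s) : 0 < size (y :: s)) => {}s s0.
rewrite /kept /=; set u := sort leq (x :: s) => ud.
have us : sorted leq u := sort_sorted leq_total _.
have xu : x \in u by rewrite mem_sort mem_head.
have sE : sort leq s = rem x u.
  apply: (sorted_eq leq_trans anti_leq); first exact: sort_sorted leq_total _.
    exact: (subseq_sorted leq_trans (rem_subseq x u)) us.
  rewrite (permPl (permEl (perm_sort leq s))).
  rewrite -(perm_cons x) -(permPr (perm_to_rem xu)) perm_sym.
  exact/permEl/perm_sort.
have : size u = (size s).+1 by rewrite size_sort.
case: u us xu sE ud => // a u us xu sE ud [uE].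
have : rank u < d (size s).
  rewrite -uE; apply: (@rank_behead _ a); rewrite ?uE //.
    exact: path_sorted us.
  exact: leq_trans ud (dS s0).
apply: leq_ltn_trans; rewrite /rank size_sort -uE; apply: leq_sum => j _.
by apply: leq_bin2l; rewrite leq_add2r sE nth_rem_sorted.
Qed.

Lemma kept_catr s t : kept d (s ++ t) -> kept d t.
Proof. by elim: s => //= x s IH /kept_behead. Qed.

Lemma kept_catl s t : kept d (s ++ t) -> kept d s.
Proof.
rewrite (perm_kept d (permEl (perm_catC s t))); exact: kept_catr.
Qed.

(** * The semigroup of kept monomials *)

Definition monomial := {s : seq nat | sorted leq s && kept d s}.

(** Sorting picks the representative of a multiset of variables; [None] is the absorbing element. *)
Definition to_monomial (s : seq nat) : option monomial := insub (sort leq s).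

Definition monomial_mul (u v : option monomial) : option monomial :=
  if (u, v) is (Some s, Some t) then to_monomial (val s ++ val t) else None.

Lemma perm_to_monomial s t : perm_eq s t -> to_monomial s = to_monomial t.
Proof. by rewrite /to_monomial => /perm_sort_leq ->. Qed.

Lemma kept_sort s : kept d (sort leq s) = kept d s.
Proof. exact/perm_kept/permEl/perm_sort. Qed.

Lemma to_monomialN s : ~~ kept d s -> to_monomial s = None.
Proof.
by move=> sN; rewrite /to_monomial insubN // kept_sort negb_and sN orbT.
Qed.

Lemma to_monomial_val u : to_monomial (val u) = Some u.
Proof.
have /andP[us _] := valP u.
by rewrite /to_monomial sorted_sort ?valK //; apply: leq_trans.
Qed.

Lemma to_monomialK s : kept d s ->
  exists2 u, to_monomial s = Some u & val u = sort leq s.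
Proof.
rewrite /to_monomial => sk; case: insubP => [u _ uE|]; first by exists u.
by rewrite kept_sort sk (sort_sorted leq_total).
Qed.

(** If a factor is discarded, closure under divisors discards the product too. Associativity of
    [monomial_mul] is then inherited from [++]. *)
Lemma to_monomial_cat s t :
  to_monomial (s ++ t) = monomial_mul (to_monomial s) (to_monomial t).
Proof.
have [sk|sN] := boolP (kept d s); last first.
  rewrite [to_monomial s]to_monomialN // to_monomialN ?(contra _ sN) //.
  exact: kept_catl.
have [tk|tN] := boolP (kept d t); last first.
  rewrite [to_monomial t]to_monomialN // to_monomialN ?(contra _ tN) //.
    by case: (to_monomial s).
  exact: kept_catr.
have [u -> uE] := to_monomialK sk; have [v -> vE] := to_monomialK tk.
apply: perm_to_monomial; rewrite uE vE perm_sym.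
by apply: perm_cat; apply/permEl/perm_sort.
Qed.

Lemma monomial_mulC : commutative monomial_mul.
Proof.
by move=> [u|] [v|] //; apply: perm_to_monomial; rewrite perm_catC.
Qed.

Lemma monomial_mulA : associative monomial_mul.
Proof.
move=> [u|] [v|] [w|] //=; rewrite ?(monomial_mulC _ None) //.
by rewrite -!to_monomial_val -!to_monomial_cat catA.
Qed.

Definition monomial_semigroup : addSemigroupType :=
  HB.pack (option monomial)
    (GRing.isAddSemigroup.Build (option monomial) monomial_mulC monomial_mulA).

(** * Cardinalities of the sumsets *)

Definition of_degree (k : nat) : set (option monomial) :=
  [set u | exists2 v : monomial, u = Some v & size (val v) = k].

Lemma card_of_degree k : 0 < k -> (of_degree k #= `I_(d k))%card.
Proof.
move=> k0; apply/card_set_bijP.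
(* [None] has no degree, so the value 0 is a dummy. *)
exists (fun u => if u is Some v then rank (val v) else 0); split.
- move=> _ [v -> vk] /=; have /andP[vs] := valP v.
  by rewrite /kept sorted_sort ?vk //; apply: leq_trans.
- move=> _ _ /set_mem[v -> vk] /set_mem[w -> wk] /= E; congr Some.
  have /andP[vs _] := valP v; have /andP[ws _] := valP w.
  by apply/val_inj/rank_inj; rewrite ?vk.
- move=> a /= ad; have [s [ss sk sa]] := rank_surj a k0.
  have sE : sort leq s = s by apply: sorted_sort => //; apply: leq_trans.
  have Ps : sorted leq s && kept d s by rewrite ss /kept sE sa sk.
  by exists (Some (Sub s Ps : monomial)) => //; exists (Sub s Ps).
Qed.

(** Split off the first variable: both factors divide a kept monomial, so both are kept. *)
Lemma of_degree_sub k :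
  of_degree k.+1 `<=` sumsetS (G := monomial_semigroup) (of_degree 1) k.
Proof.
elim: k => // k IH _ [u -> uk].
have /andP[_ sk] := valP u.
case E : (val u) sk uk => [//|x s] sk [sz].
have [v vE vx] := to_monomialK (@kept_catl [:: x] s sk).
have [w wE ws] := to_monomialK (kept_behead sk).
exists (Some v); first by exists v; rewrite ?vx.
exists (Some w); first by apply: IH; exists w; rewrite ?ws ?size_sort.
by rewrite -[RHS]to_monomial_val E -cat1s to_monomial_cat vE wE.
Qed.

Lemma sumset_sub k :
  sumsetS (G := monomial_semigroup) (of_degree 1) k
    `<=` None |` of_degree k.+1.
Proof.
elim: k => [|k IH]; first exact: subsetUr.
move=> _ [_ [u -> u1] [w /IH [->|[v -> vk]] <-]]; first by left.
have [uvk|uvN] := boolP (kept d (val u ++ val v)); last first.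
  by left; apply: to_monomialN.
have [w' wE ws] := to_monomialK uvk.
by right; exists w'; [exact: wE | rewrite ws size_sort size_cat u1 vk].
Qed.

End Macaulay_semigroup.

Lemma card_setU1_bounds {T : Type} (B C : set T) x k :
  (B #= `I_k)%card -> B `<=` C -> C `<=` x |` B ->
  exists2 n, (C #= `I_n)%card & k <= n <= k + 1.
Proof.
move=> Bk BC CB; have [Cx|Cx] := pselect (C x /\ ~ B x); last first.
  exists k; last by rewrite leqnn leq_addr.
  suff -> : C = B by [].
  apply/seteqP; split=> // y Cy; case: (CB y Cy) => // yx.
  by apply: contrapT => By; apply: Cx; rewrite -yx.
exists k.+1; last by rewrite leqnSn addn1 /=.
apply/eq_cardSP; exists x; first by case: Cx.
suff -> : C `\ x = B by [].
apply/seteqP; split=> [y [Cy yx]|y By]; first by case: (CB y Cy).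
by split; [exact: BC | move=> yx; case: Cx => _; rewrite -yx].
Qed.

Theorem theorem3p5 (d : nat -> nat) :
  d 0%N = 1%N ->
  (forall i : nat, (1 <= i)%N -> (d i.+1 <= macaulay i (d i))%N) ->
  exists (G : addSemigroupType) (A : set G),
    forall h : nat,
      exists2 n : nat, (sumset A h #= `I_n)%card & (d h <= n <= d h + 1)%N.
Proof.
move=> d0 dS; exists (monomial_semigroup d0 dS), (of_degree (d := d) 1).
case=> [|k].
  (* Here [None] is the formal zero of 0A, not the absorbing element. *)
  by exists 1; [exact: card_set1 | rewrite d0].
(* The only possible extra element of the sumset is the absorbing one. *)
have [n nE nd] := card_setU1_bounds
  (card_of_degree d (ltn0Sn k)) (@of_degree_sub d d0 dS k)
  (@sumset_sub d d0 dS k).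
exists n => //; apply: card_eq_trans nE; apply: inj_card_eq.
by move=> x y _ _ [].
Qed.
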